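(* Let $I$ be a compact interval with endpoints $c,d$ and nonempty interior $J$, and let $f,g\in\mathrm{Diffeo}(I)$, both fixed-point-free on $J$, both in $S_-$. Then the following conditions are equivalent: (1) $f$ is conjugate to $g$ in $\mathrm{Diffeo}(I)$, i.e. there is $h\in\mathrm{Diffeo}(I)$ with $f=h^{-1}\circ g\circ h$; (2) the product $H(x,\xi)$ converges for some (and hence for all) $x,\xi\in J$, and there exist some $a\in J$ and $\alpha\in J$ such that the solution $\Phi_+(a,\alpha)$ extends $C^\infty$ to both ends of $I$; (3) there exist $a,\alpha\in J$ such that $H(a,\alpha)$ converges, and $\Phi_+(a,\alpha)=\Phi_-(a,\alpha)$, and this function extends to an element of $\mathrm{Diffeo}(I)$.
   Context: $\mathrm{Diffeo}(I)$ is the group of infinitely differentiable diffeomorphisms of $I$ (one-sided derivatives at endpoints). The endpoints of $I$ are labelled $c$ (initial) and $d$ (final), in either order on the line, and $S_-$ is the set of diffeomorphisms $f$ of $I$ whose forward iterates move every point of $J$ towards $d$: $f^{\circ n}(x)\to d$ as $n\to\infty$ for every $x\in J$. $f^{\circ n}$ ($n\in\mathbb Z$) denotes the $n$-th iterate, negative $n$ referring to iterates of the inverse. For $x,\xi\in J$ put $$H_1(x,\xi)=\prod_{n=0}^{\infty}\frac{f'(f^{\circ n}(x))}{g'(g^{\circ n}(\xi))},\qquad H_2(x,\xi)=\prod_{n=1}^{\infty}\frac{g'(g^{\circ -n}(\xi))}{f'(f^{\circ -n}(x))},$$ $$H(x,\xi)=\frac{H_1(x,\xi)}{H_2(x,\xi)}=\prod_{n=-\infty}^{\infty}\frac{f'(f^{\circ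 n}(x))}{g'(g^{\circ n}(\xi))}.$$ Convergence of a product means convergence to a nonzero limit, and for the two-sided product it means that both one-sided products converge. If $H(x,\xi)$ converges for some $x,\xi\in J$ then it does so for all, and $H_1,H_2$ are smooth and positive on $J\times J$. In that case, given $a,\alpha\in J$: - there is a unique $\lambda>0$ such that the solution $\phi$ of $\phi'(x)=\lambda H_1(x,\phi(x))$, $\phi(a)=\alpha$, satisfies $\phi(f(a))=g(\alpha)$; this solution (defined on $J$) is denoted $\Phi_+(a,\alpha)$; - there is a unique $\mu>0$ such that the solution $\psi$ of $\psi'(x)=\mu H_2(x,\psi(x))$, $\psi(a)=\alpha$, satisfies $\psi(f(a))=g(\alpha)$; this solution (defined on $J$) is denoted $\Phi_-(a,\alpha)$. *)

(* Defs.v *)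
From Stdlib Require Import Reals.
From Coquelicot Require Import Coquelicot.
Open Scope R_scope.

(* The endpoints [c] (initial) and [d] (final) may come in either order. *)
Definition in_I (c d x : R) : Prop := Rmin c d <= x <= Rmax c d.
Definition in_J (c d x : R) : Prop := Rmin c d < x < Rmax c d.

(* [D_in F F' D x] is differentiability at [x] relative to the domain [D]:
   two-sided at points of J, one-sided at the endpoints of I.  The values of
   [u] outside I are irrelevant. *)
Definition smooth_on_I (c d : R) (u : R -> R) : Prop :=
  exists D : nat -> R -> R,
    (forall x, in_I c d x -> D 0%nat x = u x) /\
    (forall n x, in_I c d x -> D_in (D n) (D (S n)) (in_I c d) x).

(* An element of Diffeo(I), packed with its inverse; only the restrictions of
   the two functions to I are meaningful. *)
Record diffeo (c d : R) : Type := Diffeo {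
  dfun :> R -> R;
  dinv : R -> R;
  dfun_maps : forall x, in_I c d x -> in_I c d (dfun x);
  dinv_maps : forall x, in_I c d x -> in_I c d (dinv x);
  dfunK : forall x, in_I c d x -> dinv (dfun x) = x;
  dinvK : forall x, in_I c d x -> dfun (dinv x) = x;
  dfun_smooth : smooth_on_I c d dfun;
  dinv_smooth : smooth_on_I c d dinv
}.

Arguments dfun {c d} _ _.
Arguments dinv {c d} _ _.

Definition fixed_point_free {c d : R} (f : diffeo c d) : Prop :=
  forall x, in_J c d x -> f x <> x.

Definition S_minus {c d : R} (f : diffeo c d) : Prop :=
  forall x, in_J c d x -> is_lim_seq (fun n => Nat.iter n f x) d.

Definition conjugate {c d : R} (f g : diffeo c d) : Prop :=
  exists h : diffeo c d,
    forall x, in_I c d x -> f x = dinv h (g (h x)).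

(* Infinite products; [prod_f_R0 u N] is u 0 * ... * u N. *)
Definition prod_converges (u : nat -> R) : Prop :=
  exists l : R, l <> 0 /\ is_lim_seq (prod_f_R0 u) l.

Definition inf_prod (u : nat -> R) : R := real (Lim_seq (prod_f_R0 u)).

Definition H1_factor {c d : R} (f g : diffeo c d) (x xi : R) (n : nat) : R :=
  Derive f (Nat.iter n f x) / Derive g (Nat.iter n g xi).

(* Factor of index n+1: the product defining H_2 starts at 1. *)
Definition H2_factor {c d : R} (f g : diffeo c d) (x xi : R) (n : nat) : R :=
  Derive g (Nat.iter (S n) (dinv g) xi) / Derive f (Nat.iter (S n) (dinv f) x).

Definition H1 {c d : R} (f g : diffeo c d) (x xi : R) : R :=
  inf_prod (H1_factor f g x xi).

Definition H2 {c d : R} (f g : diffeo c d) (x xi : R) : R :=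
  inf_prod (H2_factor f g x xi).

(* Convergence of the two-sided product H = H_1 / H_2. *)
Definition H_converges {c d : R} (f g : diffeo c d) (x xi : R) : Prop :=
  prod_converges (H1_factor f g x xi) /\ prod_converges (H2_factor f g x xi).

(* [phi], as a J-valued function on J, solves phi' = K(x, phi), phi(a) = alpha. *)
Definition solves_on_J (c d : R) (K : R -> R -> R) (a alpha : R)
    (phi : R -> R) : Prop :=
  (forall x, in_J c d x -> in_J c d (phi x)) /\
  (forall x, in_J c d x -> is_derive phi x (K x (phi x))) /\
  phi a = alpha.

(* [phi] is Phi_+(a, alpha), resp. Phi_-(a, alpha), on J.  When H converges
   the multiplier is unique, so this determines [phi] on J; without
   convergence of H the predicates carry no meaning. *)
Definition is_Phi_plus {c d : R} (f g : diffeo c d) (a alpha : R)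
    (phi : R -> R) : Prop :=
  exists lambda : R, 0 < lambda /\
    solves_on_J c d (fun x y => lambda * H1 f g x y) a alpha phi /\
    phi (f a) = g alpha.

Definition is_Phi_minus {c d : R} (f g : diffeo c d) (a alpha : R)
    (psi : R -> R) : Prop :=
  exists mu : R, 0 < mu /\
    solves_on_J c d (fun x y => mu * H2 f g x y) a alpha psi /\
    psi (f a) = g alpha.

Definition extends_smoothly (c d : R) (phi : R -> R) : Prop :=
  exists u : R -> R, smooth_on_I c d u /\ forall x, in_J c d x -> u x = phi x.

Definition extends_to_diffeo (c d : R) (phi : R -> R) : Prop :=
  exists h : diffeo c d, forall x, in_J c d x -> h x = phi x.

(* Main.v *)
Require Import Defs.
From Stdlib Require Import Reals Lra Lia ClassicalEpsilon.
From Coquelicot Require Import Coquelicot.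
Open Scope R_scope.

(** The maps [f] and [g] preserve orientation, as a reversing map has an
    interior fixed point; so does every conjugacy, as the forward orbits of
    both maps tend to [d].  The two directions of the
    equivalence rest on one identity.  Differentiating [h o f = g o h] gives
    [f'(x) / g'(h x) = h'(x) / h'(f x)], so the partial products of [H1] and
    [H2] at [(x, h x)] telescope to [h'(x) / h'(f^N x)] and
    [h'(x) / h'(f^-N x)] ([H1_telescopes]).

    If [h] is a conjugacy, these tend to [h'(x) / h'(d)] and [h'(x) / h'(c)]
    because [h'] is continuous and nonzero up to the endpoints.  Hence [H]
    converges along the graph of [h], and [h] is at once [Phi_+] with
    multiplier [h'(d)] and [Phi_-] with multiplier [h'(c)]
    ([conjugacy_is_Phi]).

    Conversely, let [H] converge somewhere.  The function [ln f'] is Lipschitz,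
    and the distances between two orbits have a finite sum, because they are
    dominated by increments of a single monotone orbit ([sweeps_summable]).
    So [H] converges everywhere, and [H1 x xi] is the product of a function of
    [x] and a positive continuous function of [xi].  The equation for
    [phi = Phi_+] thus has separated variables, which gives uniqueness
    ([separable_unique]); the shift of the product by one step shows that
    [phi o f] and [g o phi] solve the same such equation with the same value
    at [a], so [phi o f = g o phi] ([Phi_plus_intertwines]).  If [phi] extends
    to a smooth [u], the telescoped products read backwards: their limits
    being nonzero, [u'] does not vanish at [d], by [H1], nor at [c], by [H2].
    A smooth map of the interval that fixes both endpoints and has no critical
    point is a diffeomorphism ([diffeo_of_smooth]), which conjugates [f] to
    [g] ([intertwining_extends_to_conjugacy]). *)

(** * The interval *)

Lemma in_J_in_I c d x : in_J c d x -> in_I c d x.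
Proof. unfold in_J, in_I. lra. Qed.

Lemma in_I_left c d : in_I c d c.
Proof. split; [apply Rmin_l | apply Rmax_l]. Qed.

Lemma in_I_right c d : in_I c d d.
Proof. split; [apply Rmin_r | apply Rmax_r]. Qed.

Lemma in_I_cases c d x : in_I c d x -> x = c \/ x = d \/ in_J c d x.
Proof.
unfold in_I, in_J, Rmin, Rmax; destruct (Rle_dec c d); intros H;
  destruct (Req_dec x c); destruct (Req_dec x d); auto; right; right; lra.
Qed.

Lemma in_J_between c d x y z :
  in_J c d x -> in_J c d y -> x <= z <= y -> in_J c d z.
Proof. unfold in_J. lra. Qed.

Lemma in_J_sym c d x : in_J c d x -> in_J d c x.
Proof. unfold in_J. now rewrite (Rmin_comm d), (Rmax_comm d). Qed.

(** Multiplying by [d - c] orients the line from [c] to [d], so that both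
    labellings of the endpoints are handled at once. *)
Lemma in_J_oriented c d x :
  in_J c d x <-> 0 < (d - c) * (x - c) /\ 0 < (d - c) * (d - x).
Proof.
unfold in_J, Rmin, Rmax; destruct (Rle_dec c d) as [H|H]; split.
- intros [H1 H2]; split; apply Rmult_lt_0_compat; lra.
- intros [H1 H2]; split; nra.
- intros [H1 H2]; split; nra.
- intros [H1 H2]; split; nra.
Qed.

Lemma in_J_midpoint c d : c <> d -> in_J c d ((c + d) / 2).
Proof. intros H; apply in_J_oriented; split; nra. Qed.

Lemma Rmin_lt_Rmax c d : c <> d -> Rmin c d < Rmax c d.
Proof. intros H; unfold Rmin, Rmax; destruct (Rle_dec c d); lra. Qed.

Lemma open_in_J c d : open (in_J c d).
Proof.
apply (open_and (fun x => Rmin c d < x) (fun x => x < Rmax c d));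
  [apply open_gt | apply open_lt].
Qed.

Lemma locally_in_J c d x : in_J c d x -> locally x (in_J c d).
Proof. exact (open_in_J c d x). Qed.

(** * Functions on the closed interval *)

(** Precomposition with the retraction onto the interval turns continuity on
    the interval, one-sided at the endpoints, into continuity on the line. *)
Definition clamp (c d x : R) : R := Rmax (Rmin c d) (Rmin x (Rmax c d)).

Lemma clamp_in_I c d x : in_I c d (clamp c d x).
Proof.
unfold in_I, clamp, Rmin, Rmax; destruct (Rle_dec c d);
  repeat destruct Rle_dec; lra.
Qed.

Lemma clamp_id c d x : in_I c d x -> clamp c d x = x.
Proof.
unfold in_I, clamp; intros [H1 H2].
rewrite (Rmin_left x) by easy; now apply Rmax_right.
Qed.

Lemma clamp_contracts c d x y :
  Rabs (clamp c d x - clamp c d y) <= Rabs (x - y).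
Proof.
unfold clamp; generalize (Rmin_Rmax c d); generalize (Rmin c d) (Rmax c d).
intros p q Hpq; unfold Rmin, Rmax; repeat destruct Rle_dec;
  unfold Rabs; repeat destruct Rcase_abs; lra.
Qed.

Definition continuous_on_I (c d : R) (u : R -> R) : Prop :=
  forall x, in_I c d x -> continue_in u (in_I c d) x.

Lemma D_in_spec F F' D x :
  D_in F F' D x <->
  forall eps, 0 < eps -> exists del, 0 < del /\ forall y, D y -> y <> x ->
    Rabs (y - x) < del -> Rabs ((F y - F x) / (y - x) - F' x) < eps.
Proof.
split.
- intros H eps Heps; destruct (H eps Heps) as (del & Hdel & H').
  exists del; split; [easy|]; intros y Dy Hy Hyx; apply H'.
  repeat split; auto.
- intros H eps Heps; destruct (H eps Heps) as (del & Hdel & H').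
  exists del; split; [easy|]; intros y [[Dy Hy] Hyx]; apply H'; auto.
Qed.

Lemma D_in_ext F G F' G' D x :
  (forall y, D y -> F y = G y) -> D x -> F' x = G' x ->
  D_in F F' D x -> D_in G G' D x.
Proof.
intros HFG Dx Hx; rewrite !D_in_spec, <- Hx; intros H eps Heps.
destruct (H eps Heps) as (del & Hdel & H').
exists del; split; [easy|]; intros y Dy; rewrite <- !HFG by easy; auto.
Qed.

Lemma continuity_clamp c d u :
  continuous_on_I c d u -> continuity (fun x => u (clamp c d x)).
Proof.
intros Hu x eps Heps.
destruct (Hu _ (clamp_in_I c d x) eps Heps) as (del & Hdel & H).
exists del; split; [easy|]; intros y [_ Hy].
destruct (Req_dec (clamp c d y) (clamp c d x)) as [E|E].
- rewrite E; cbn; unfold Rdist; now rewrite Rminus_diag, Rabs_R0.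
- apply H; repeat split; [apply clamp_in_I .. | auto |].
  eapply Rle_lt_trans; [apply clamp_contracts | exact Hy].
Qed.

Lemma continuous_on_I_lim c d u x l :
  continuous_on_I c d u -> (forall n, in_I c d (x n)) -> in_I c d l ->
  is_lim_seq x l -> is_lim_seq (fun n => u (x n)) (u l).
Proof.
intros Hu Hx Hl Hlim; rewrite <- (clamp_id c d l Hl).
apply is_lim_seq_ext with (fun n => u (clamp c d (x n))).
- intros n; now rewrite clamp_id.
- apply (is_lim_seq_continuous (fun z => u (clamp c d z))); [|easy].
  now apply continuity_clamp.
Qed.

Lemma continuous_on_I_bounded c d u :
  continuous_on_I c d u ->
  exists M, 0 < M /\ forall x, in_I c d x -> Rabs (u x) <= M.
Proof.
intros Hu.
destruct (continuity_ab_maj (fun x => Rabs (u (clamp c d x)))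
  (Rmin c d) (Rmax c d)) as (m & Hm & _).
- apply Rmin_Rmax.
- intros x _; apply (continuity_pt_comp (fun y => u (clamp c d y)) Rabs).
  + now apply continuity_clamp.
  + apply Rcontinuity_abs.
- exists (Rabs (u (clamp c d m)) + 1); split.
  + pose proof (Rabs_pos (u (clamp c d m))); lra.
  + intros x Hx; specialize (Hm x Hx); cbv beta in Hm.
    rewrite (clamp_id c d x Hx) in Hm; lra.
Qed.

Lemma D_in_continuous_on_I c d F F' :
  (forall x, in_I c d x -> D_in F F' (in_I c d) x) -> continuous_on_I c d F.
Proof. intros H x Hx; eapply cont_deriv, H, Hx. Qed.

Lemma D_in_is_derive c d F F' x :
  in_J c d x -> D_in F F' (in_I c d) x -> is_derive F x (F' x).
Proof.
intros Hx H; apply is_derive_Reals; intros eps Heps.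
destruct (proj1 (D_in_spec _ _ _ _) H eps Heps) as (del & Hdel & H').
destruct (locally_in_J c d x Hx) as [del' H''].
assert (Hm : 0 < Rmin del del').
{ apply Rmin_pos; [easy | apply cond_pos]. }
exists (mkposreal _ Hm); intros h Hh Hhm; cbn in Hhm.
assert (Hh1 := Rmin_l del del'); assert (Hh2 := Rmin_r del del').
replace ((F (x + h) - F x) / h) with ((F (x + h) - F x) / (x + h - x))
  by (f_equal; ring).
apply H'.
- apply in_J_in_I, H''; unfold ball; cbn.
  unfold AbsRing_ball, abs, minus, plus, opp; cbn.
  replace (x + h + - x) with h by ring; lra.
- lra.
- replace (x + h - x) with h by ring; lra.
Qed.

Lemma D_in_unique c d F F1 F2 x :
  c <> d -> in_I c d x ->
  D_in F F1 (in_I c d) x -> D_in F F2 (in_I c d) x -> F1 x = F2 x.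
Proof.
intros Hcd Hx H1 H2; eapply single_limit; [| exact H1 | exact H2].
intros alp Halp; unfold D_x, Rdist.
assert (Hpq := Rmin_lt_Rmax c d Hcd); unfold in_I in *.
assert (Hz : forall z, Rmin c d <= z <= Rmax c d -> x <> z ->
  -alp < z - x < alp ->
  exists z, ((Rmin c d <= z <= Rmax c d) /\ x <> z) /\ Rabs (z - x) < alp).
{ intros z ? ? ?; exists z; repeat split; try apply Rabs_def1; tauto || lra. }
destruct (Rlt_le_dec x (Rmax c d)) as [L|L].
- destruct (Rle_dec (x + alp / 2) (Rmax c d));
    [apply (Hz (x + alp / 2)) | apply (Hz (Rmax c d))]; lra.
- destruct (Rle_dec (Rmin c d) (x - alp / 2));
    [apply (Hz (x - alp / 2)) | apply (Hz (Rmin c d))]; lra.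
Qed.

(** * Smooth functions and their inverses *)

Definition derivatives (c d : R) (u : R -> R) (D : nat -> R -> R) : Prop :=
  (forall x, in_I c d x -> D 0%nat x = u x) /\
  (forall n x, in_I c d x -> D_in (D n) (D (S n)) (in_I c d) x).

Lemma derivatives_D_in c d u D x :
  derivatives c d u D -> in_I c d x -> D_in u (D 1%nat) (in_I c d) x.
Proof.
intros [H0 HS] Hx; apply (D_in_ext (D 0%nat) u (D 1%nat) (D 1%nat)); auto.
Qed.

Lemma derivatives_continuous c d u D n :
  derivatives c d u D -> continuous_on_I c d (D n).
Proof. intros [_ HS]; apply (D_in_continuous_on_I c d _ (D (S n))); auto. Qed.

Lemma smooth_continuous c d u D :
  derivatives c d u D -> continuous_on_I c d u.
Proof.
intros HD; apply (D_in_continuous_on_I c d _ (D 1%nat)).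
intros x; now apply derivatives_D_in.
Qed.

Lemma derivatives_is_derive c d u D x :
  derivatives c d u D -> in_J c d x -> is_derive u x (D 1%nat x).
Proof.
intros HD Hx; apply (D_in_is_derive c d); [easy|].
apply derivatives_D_in; [easy | now apply in_J_in_I].
Qed.

Lemma derivatives_Derive c d u D x :
  derivatives c d u D -> in_J c d x -> Derive u x = D 1%nat x.
Proof.
intros HD Hx; apply is_derive_unique; now apply (derivatives_is_derive c d).
Qed.

(** Smoothness is the largest property of functions that passes to some
    derivative; the tower of derivatives comes from dependent choice. *)
Lemma smooth_coinduction c d (P : (R -> R) -> Prop) u :
  (forall F, P F -> exists F', P F' /\
     forall x, in_I c d x -> D_in F F' (in_I c d) x) ->
  P u -> smooth_on_I c d u.
Proof.
intros HP Hu.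
pose (next (F : {F | P F}) :=
  constructive_indefinite_description _ (HP _ (proj2_sig F))).
pose (D n := Nat.iter n
  (fun F => exist P (proj1_sig (next F)) (proj1 (proj2_sig (next F))))
  (exist P u Hu)).
exists (fun n => proj1_sig (D n)); split; [easy|].
intros n x Hx; cbn; now apply (proj2_sig (next (D n))).
Qed.

Lemma D_in_inverse c d u u' v y :
  (forall y, in_I c d y -> in_I c d (v y)) ->
  (forall y, in_I c d y -> u (v y) = y) ->
  continue_in v (in_I c d) y -> in_I c d y ->
  D_in u u' (in_I c d) (v y) -> u' (v y) <> 0 ->
  D_in v (fun z => / u' (v z)) (in_I c d) y.
Proof.
intros Hv Huv Cv Hy Du Hu' eps Heps.
destruct (limit_inv _ _ _ _ Du Hu' eps Heps) as (del & Hdel & H).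
destruct (Cv del Hdel) as (del' & Hdel' & H').
exists del'; split; [easy|]; intros z [[Hz Hzy] Hzd].
assert (Hne : v z <> v y).
{ intros E; apply Hzy; rewrite <- (Huv z), <- (Huv y) by easy; now rewrite E. }
replace ((v z - v y) / (z - y)) with (/ ((u (v z) - u (v y)) / (v z - v y))).
- apply H; split; [split; auto|]; apply H'; split; [split|]; auto.
- rewrite !Huv by easy; field; lra.
Qed.

Inductive generated (D : nat -> R -> R) (w : R -> R) : (R -> R) -> Prop :=
| gen_const r : generated D w (fun _ => r)
| gen_D n : generated D w (D n)
| gen_w : generated D w w
| gen_plus F G : generated D w F -> generated D w G ->
    generated D w (fun x => F x + G x)
| gen_mult F G : generated D w F -> generated D w G ->
    generated D w (fun x => F x * G x).

(** With [w = 1 / u'] one has [w' = - w^2 u''], which stays in the algebra. *)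
Lemma generated_D_in c d u D F :
  derivatives c d u D -> (forall x, in_I c d x -> D 1%nat x <> 0) ->
  generated D (fun x => / D 1%nat x) F ->
  exists F', generated D (fun x => / D 1%nat x) F' /\
    forall x, in_I c d x -> D_in F F' (in_I c d) x.
Proof.
intros HD Hne; induction 1 as [r | n | | F G HF [F' [gF' dF]] HG [G' [gG' dG]]
  | F G HF [F' [gF' dF]] HG [G' [gG' dG]]].
- exists (fun _ => 0); split; [constructor|].
  intros x Hx; apply Dconst.
- exists (D (S n)); split; [constructor|]; intros x; apply HD.
- exists (fun x => D 2%nat x * (-1 * (/ D 1%nat x * / D 1%nat x))); split.
  + repeat constructor.
  + intros x Hx.
    assert (Di : D_in Rinv (fun y => - 1 * (/ y * / y)) no_cond (D 1%nat x)).
    { apply derivable_pt_lim_D_in, is_derive_Reals.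
      auto_derive; [now apply Hne|]; field; now apply Hne. }
    pose proof (Dcomp _ _ _ _ _ _ _ (proj2 HD 1%nat x Hx) Di) as Hc.
    apply D_in_spec; intros eps Heps.
    destruct (proj1 (D_in_spec _ _ _ _) Hc eps Heps) as (del & Hdel & Hd).
    exists del; split; [easy|]; intros y Hy; apply Hd; now split.
- exists (fun x => F' x + G' x); split; [now constructor|].
  intros x Hx; apply Dadd; auto.
- exists (fun x => F' x * G x + F x * G' x); split; [now repeat constructor|].
  intros x Hx; apply Dmult; auto.
Qed.

(** Every iterated derivative of [v = u^-1] is an element of the algebra
    generated by the derivatives of [u] and [w = 1 / u'], composed with [v]:
    the derivative of [F o v] is [(F' w) o v]. *)
Lemma smooth_inverse c d u D v :
  derivatives c d u D -> (forall x, in_I c d x -> D 1%nat x <> 0) ->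
  (forall y, in_I c d y -> in_I c d (v y)) ->
  (forall y, in_I c d y -> u (v y) = y) ->
  continuous_on_I c d v -> smooth_on_I c d v.
Proof.
intros HD Hne Hv Huv Cv.
assert (dv : forall y, in_I c d y ->
  D_in v (fun z => / D 1%nat (v z)) (in_I c d) y).
{ intros y Hy; apply D_in_inverse with u; auto.
  apply derivatives_D_in; auto. }
apply (smooth_coinduction c d (fun F => F = v \/ exists G,
  generated D (fun x => / D 1%nat x) G /\ F = fun y => G (v y)));
  [|now left].
intros F [-> | (G & gG & ->)].
- exists (fun z => / D 1%nat (v z)); split; [|easy].
  right; exists (fun x => / D 1%nat x); split; [constructor | easy].
- destruct (generated_D_in c d u D G HD Hne gG) as (G' & gG' & dG).
  exists (fun y => / D 1%nat (v y) * G' (v y)); split.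
  + right; exists (fun x => / D 1%nat x * G' x); split; [|easy].
    now repeat constructor.
  + intros y Hy.
    pose proof (Dcomp _ _ _ _ _ _ _ (dv y Hy) (dG (v y) (Hv y Hy))) as Hc.
    apply D_in_spec; intros eps Heps.
    destruct (proj1 (D_in_spec _ _ _ _) Hc eps Heps) as (del & Hdel & Hd).
    exists del; split; [easy|]; intros z Hz; apply Hd; split; auto.
Qed.

(** By compactness [|u'|] is bounded below, so that [u] does not contract
    distances by more than a constant factor. *)
Lemma smooth_expands c d u D :
  derivatives c d u D -> (forall x, in_I c d x -> D 1%nat x <> 0) ->
  exists M, 0 < M /\ forall x y, in_I c d x -> in_I c d y ->
    Rabs (x - y) <= M * Rabs (u x - u y).
Proof.
intros HD Hne.
assert (Cw : continuous_on_I c d (fun x => / D 1%nat x)).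
{ intros x Hx; apply (limit_inv (D 1%nat)); [|auto].
  now apply derivatives_continuous with u. }
destruct (continuous_on_I_bounded c d _ Cw) as (M & HM & HMb).
exists M; split; [easy|]; intros x y Hx Hy.
destruct (MVT_gen (fun z => u (clamp c d z)) x y (D 1%nat)) as (z & Hz & E).
- intros z Hz; assert (HzJ : in_J c d z).
  { unfold in_J, in_I, Rmin, Rmax in *; repeat destruct Rle_dec; lra. }
  apply is_derive_ext_loc with u.
  + apply filter_imp with (2 := locally_in_J c d z HzJ).
    intros t Ht; now rewrite clamp_id by now apply in_J_in_I.
  + now apply derivatives_is_derive with c d.
- intros z _; apply continuity_clamp; now apply smooth_continuous with D.
- rewrite !clamp_id in E by easy.
  assert (HzI : in_I c d z).
  { unfold in_I, Rmin, Rmax in *; repeat destruct Rle_dec; lra. }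
  rewrite (Rabs_minus_sym x y), (Rabs_minus_sym (u x)), E.
  replace (y - x) with (/ D 1%nat z * (D 1%nat z * (y - x))) at 1
    by (field; auto).
  rewrite Rabs_mult; apply Rmult_le_compat_r; [apply Rabs_pos | auto].
Qed.

Lemma diffeo_of_smooth c d u D :
  derivatives c d u D -> (forall x, in_I c d x -> D 1%nat x <> 0) ->
  (forall x, in_I c d x -> in_I c d (u x)) -> u c = c -> u d = d ->
  exists h : diffeo c d, forall x, h x = u x.
Proof.
intros HD Hne Hu Hc Hd.
destruct (smooth_expands c d u D HD Hne) as (M & HM & HMb).
assert (Hsurj : forall y, exists x, in_I c d y -> in_I c d x /\ u x = y).
{ intros y; destruct (excluded_middle_informative (in_I c d y)) as [Hy|Hy];
    [|now exists y].
  destruct (IVT_gen (fun x => u (clamp c d x)) c d y) as (x & Hx & E).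
  - apply continuity_clamp; now apply smooth_continuous with D.
  - rewrite !clamp_id by (apply in_I_left || apply in_I_right).
    now rewrite Hc, Hd.
  - exists x; intros _; split; [easy|]; now rewrite clamp_id in E. }
pose (v y := proj1_sig (constructive_indefinite_description _ (Hsurj y))).
assert (Hv : forall y, in_I c d y -> in_I c d (v y) /\ u (v y) = y).
{ intros y; exact (proj2_sig (constructive_indefinite_description _ (Hsurj y))). }
assert (Hinj : forall x, in_I c d x -> v (u x) = x).
{ intros x Hx; destruct (Hv (u x) (Hu x Hx)) as [H1 H2].
  pose proof (HMb _ _ H1 Hx) as H; rewrite H2, Rminus_diag, Rabs_R0 in H.
  pose proof (Rabs_pos (v (u x) - x)).
  assert (E : Rabs (v (u x) - x) = 0) by lra.
  apply Rabs_eq_0 in E; lra. }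
assert (Cv : continuous_on_I c d v).
{ intros y Hy eps Heps; exists (eps / M); split; [now apply Rdiv_lt_0_compat|].
  intros z [[Hz _] Hzy]; cbn in *; unfold Rdist in *.
  destruct (Hv y Hy) as [H1 H2], (Hv z Hz) as [H3 H4].
  eapply Rle_lt_trans; [apply HMb; easy|]; rewrite H2, H4.
  apply Rmult_lt_compat_l with (r := M) in Hzy; [|easy].
  now replace (M * (eps / M)) with eps in Hzy by (field; lra). }
assert (Sv : smooth_on_I c d v).
{ apply smooth_inverse with u D; auto; now intros y Hy; apply Hv. }
assert (Su : smooth_on_I c d u) by (now exists D).
now exists (Diffeo c d u v Hu (fun y Hy => proj1 (Hv y Hy)) Hinj
  (fun y Hy => proj2 (Hv y Hy)) Su Sv).
Qed.

(** * Diffeomorphisms of the interval *)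

Definition diffeo_inv {c d : R} (h : diffeo c d) : diffeo c d :=
  Diffeo c d (dinv h) h (dinv_maps c d h) (dfun_maps c d h)
    (dinvK c d h) (dfunK c d h) (dinv_smooth c d h) (dfun_smooth c d h).

Lemma diffeo_derivatives c d (h : diffeo c d) :
  c <> d -> exists D E, derivatives c d h D /\ derivatives c d (dinv h) E /\
    forall x, in_I c d x -> D 1%nat x * E 1%nat (h x) = 1.
Proof.
intros Hcd; destruct (dfun_smooth c d h) as [D HD].
destruct (dinv_smooth c d h) as [E HE].
exists D, E; split; [easy|]; split; [easy|]; intros x Hx.
apply (D_in_unique c d (fun y => y)
  (fun x => D 1%nat x * E 1%nat (h x)) (fun _ => 1) x Hcd Hx).
- pose proof (Dcomp _ _ _ _ _ _ _ (derivatives_D_in c d h D x HD Hx)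
    (derivatives_D_in c d _ E (h x) HE (dfun_maps c d h x Hx))) as Hc.
  apply D_in_spec; intros eps Heps.
  destruct (proj1 (D_in_spec _ _ _ _) Hc eps Heps) as (del & Hdel & Hd).
  exists del; split; [easy|]; intros y Hy.
  assert (HDg : Dgf (in_I c d) (in_I c d) h y).
  { split; [easy | now apply (dfun_maps c d h)]. }
  specialize (Hd y HDg); now rewrite !(dfunK c d h) in Hd.
- apply Dx.
Qed.

Lemma diffeo_is_derive c d (h : diffeo c d) x :
  in_J c d x -> is_derive h x (Derive h x).
Proof.
intros Hx; destruct (dfun_smooth c d h) as [D HD].
rewrite (derivatives_Derive c d h D) by easy.
now apply (derivatives_is_derive c d).
Qed.

Lemma diffeo_Derive_neq0 c d (h : diffeo c d) x :
  c <> d -> in_J c d x -> Derive h x <> 0.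
Proof.
intros Hcd Hx; destruct (diffeo_derivatives c d h Hcd) as (D & E & HD & _ & H).
rewrite (derivatives_Derive c d h D) by easy; intros E0.
specialize (H x (in_J_in_I c d x Hx)); rewrite E0 in H; lra.
Qed.

(** An interior point sent to an endpoint would be an extremum of [h], hence
    a critical point. *)
Lemma diffeo_maps_J c d (h : diffeo c d) x :
  c <> d -> in_J c d x -> in_J c d (h x).
Proof.
intros Hcd Hx.
assert (Hd : derivable_pt h x).
{ apply ex_derive_Reals_0; eexists; now apply diffeo_is_derive. }
assert (Hne : derive_pt h x Hd <> 0).
{ rewrite Derive_Reals; now apply diffeo_Derive_neq0. }
assert (Hm := fun y (Hy : Rmin c d < y < Rmax c d) =>
  dfun_maps c d h y (in_J_in_I c d y Hy)).
assert (H0 := Hm x Hx); unfold in_I, in_J in *.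
split; apply Rnot_le_lt; intros Hle; apply Hne.
- apply deriv_minimum with (Rmin c d) (Rmax c d); try easy.
  intros y H1 H2; specialize (Hm y (conj H1 H2)); lra.
- apply deriv_maximum with (Rmin c d) (Rmax c d); try easy.
  intros y H1 H2; specialize (Hm y (conj H1 H2)); lra.
Qed.

Lemma dinv_maps_J c d (h : diffeo c d) x :
  c <> d -> in_J c d x -> in_J c d (dinv h x).
Proof. exact (diffeo_maps_J c d (diffeo_inv h) x). Qed.

Lemma increasing_on_J c d (u du : R -> R) :
  (forall x, in_J c d x -> is_derive u x (du x)) ->
  (forall x, in_J c d x -> 0 < du x) ->
  forall x y, in_J c d x -> in_J c d y -> x < y -> u x < u y.
Proof.
intros Hd Hp x y [Hx _] [_ Hy] Hxy.
apply (incr_function u (Rmin c d) (Rmax c d) du); try easy.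
- intros z H1 H2; now apply Hd.
- intros z H1 H2; now apply Hp.
Qed.

Lemma diffeo_monotone c d (h : diffeo c d) :
  c <> d -> (forall x, in_J c d x -> 0 < Derive h x) \/
            (forall x, in_J c d x -> Derive h x < 0).
Proof.
intros Hcd; destruct (diffeo_derivatives c d h Hcd) as (D & E & HD & _ & H).
assert (Hne : forall x, in_I c d x -> D 1%nat x <> 0).
{ intros x Hx E0; specialize (H x Hx); rewrite E0 in H; lra. }
(* By the intermediate value theorem [h'] has the sign of its value at [c]. *)
assert (Hs : forall x, in_I c d x -> 0 < D 1%nat c * D 1%nat x).
{ intros x Hx; apply Rnot_le_lt; intros Hle.
  assert (Hc := in_I_left c d).
  destruct (IVT_gen (fun z => D 1%nat (clamp c d z)) c x 0) as (z & _ & Hz).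
  - apply continuity_clamp; now apply derivatives_continuous with h.
  - rewrite !clamp_id by easy; unfold Rmin, Rmax; destruct Rle_dec; nra.
  - now apply (Hne _ (clamp_in_I c d z)). }
assert (Hc0 := Hne c (in_I_left c d)).
destruct (Rlt_le_dec 0 (D 1%nat c)); [left | right]; intros x Hx;
  rewrite (derivatives_Derive c d h D) by easy;
  specialize (Hs x (in_J_in_I c d x Hx)); nra.
Qed.

(** [(ln h')' = h'' / h'] is bounded on the interval. *)
Lemma ln_Derive_Lipschitz c d (h : diffeo c d) :
  c <> d -> (forall x, in_J c d x -> 0 < Derive h x) ->
  exists K, 0 < K /\ forall x y, in_J c d x -> in_J c d y ->
    Rabs (ln (Derive h x) - ln (Derive h y)) <= K * Rabs (x - y).
Proof.
intros Hcd Hpos.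
destruct (diffeo_derivatives c d h Hcd) as (D & E & HD & HE & H).
destruct (continuous_on_I_bounded c d _ (derivatives_continuous c d h D 2 HD))
  as (M2 & HM2 & B2).
destruct (continuous_on_I_bounded c d _ (derivatives_continuous c d _ E 1 HE))
  as (M1 & HM1 & B1).
exists (M2 * M1); split; [now apply Rmult_lt_0_compat|]; intros x y Hx Hy.
rewrite !(derivatives_Derive c d h D) by easy.
assert (HJ : forall z, Rmin y x <= z <= Rmax y x -> in_J c d z).
{ intros z; unfold in_J in *; unfold Rmin at 1, Rmax at 1; destruct Rle_dec; lra. }
assert (Hd : forall z, in_J c d z -> is_derive (fun t => ln (D 1%nat t)) z
  (D 2%nat z * E 1%nat (h z))).
{ intros z Hz; assert (HzI := in_J_in_I c d z Hz); assert (HzE := H z HzI).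
  assert (Hp := Hpos z Hz); rewrite (derivatives_Derive c d h D) in Hp by easy.
  replace (E 1%nat (h z)) with (/ D 1%nat z).
  2:{ apply Rmult_eq_reg_l with (D 1%nat z); [rewrite HzE; field|]; lra. }
  apply (is_derive_comp ln (D 1%nat)).
  - apply is_derive_Reals; now apply derivable_pt_lim_ln.
  - apply (D_in_is_derive c d); [easy|]; now apply (proj2 HD). }
destruct (MVT_gen (fun t => ln (D 1%nat t)) y x
  (fun z => D 2%nat z * E 1%nat (h z))) as (z & Hz & Eq).
- intros z Hz; apply Hd, HJ; lra.
- intros z Hz; apply derivable_continuous_pt, ex_derive_Reals_0.
  eexists; apply Hd, HJ, Hz.
- rewrite Eq, !Rabs_mult; apply Rmult_le_compat_r; [apply Rabs_pos|].
  assert (HzI := in_J_in_I c d z (HJ z Hz)).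
  apply Rmult_le_compat; try apply Rabs_pos; [now apply B2|].
  now apply B1, (dfun_maps c d h).
Qed.

(** * Dynamics of a fixed-point-free diffeomorphism *)

Lemma iter_in_J c d (F : R -> R) n x :
  (forall y, in_J c d y -> in_J c d (F y)) -> in_J c d x ->
  in_J c d (Nat.iter n F x).
Proof. intros HF Hx; induction n; cbn; auto. Qed.

Lemma iter_increasing c d (F : R -> R) n x y :
  (forall y, in_J c d y -> in_J c d (F y)) ->
  (forall x y, in_J c d x -> in_J c d y -> x < y -> F x < F y) ->
  in_J c d x -> in_J c d y -> x <= y -> Nat.iter n F x <= Nat.iter n F y.
Proof.
intros HF Hi Hx Hy [Hxy | ->]; [|lra].
left; induction n as [|n IH]; cbn; [easy|].
apply Hi; auto; now apply iter_in_J.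
Qed.

(** If [f] reversed the orientation, [f x] and [f (f x)] would lie on either
    side of a fixed point. *)
Lemma fixed_point_free_increasing c d (f : diffeo c d) :
  c <> d -> fixed_point_free f -> forall x, in_J c d x -> 0 < Derive f x.
Proof.
intros Hcd Hf; destruct (diffeo_monotone c d f Hcd) as [|Hneg]; [easy|exfalso].
set (x := (c + d) / 2); assert (Hx : in_J c d x) by now apply in_J_midpoint.
assert (Hfx := diffeo_maps_J c d f x Hcd Hx).
assert (Hdec : forall y z, in_J c d y -> in_J c d z -> y < z -> f z < f y).
{ intros y z Hy Hz Hyz.
  assert (- f y < - f z); [|lra].
  apply (increasing_on_J c d (fun t => - f t) (fun t => - Derive f t)); auto.
  - intros t Ht; apply (is_derive_opp f); now apply diffeo_is_derive.
  - intros t Ht; specialize (Hneg t Ht); lra. }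
destruct (dfun_smooth c d f) as [D HD].
destruct (IVT_gen (fun z => f (clamp c d z) - clamp c d z) x (f x) 0)
  as (z & Hz & Ez).
- assert (C1 := continuity_clamp c d f (smooth_continuous c d f D HD)).
  assert (C2 : continuity (fun z => clamp c d z)).
  { apply (continuity_clamp c d (fun z => z)).
    apply (D_in_continuous_on_I c d _ (fun _ => 1)); intros y _; apply Dx. }
  intros y; exact (continuity_pt_minus _ _ y (C1 y) (C2 y)).
- rewrite !clamp_id by now apply in_J_in_I.
  destruct (Rtotal_order (f x) x) as [L | [E | L]].
  + specialize (Hdec _ _ Hfx Hx L).
    unfold Rmin, Rmax; destruct Rle_dec; lra.
  + now destruct (Hf x Hx).
  + specialize (Hdec _ _ Hx Hfx L).
    unfold Rmin, Rmax; destruct Rle_dec; lra.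
- assert (HzJ : in_J c d z).
  { unfold in_J in *; unfold Rmin at 1, Rmax at 1 in Hz.
    destruct Rle_dec; lra. }
  rewrite clamp_id in Ez by now apply in_J_in_I.
  apply (Hf z HzJ); lra.
Qed.

Lemma diffeo_increasing c d (h : diffeo c d) :
  (forall x, in_J c d x -> 0 < Derive h x) ->
  forall x y, in_J c d x -> in_J c d y -> x < y -> h x < h y.
Proof.
intros Hp; apply (increasing_on_J c d h (Derive h)); [|easy].
intros x; apply diffeo_is_derive.
Qed.

Lemma dinv_increasing c d (h : diffeo c d) :
  c <> d -> (forall x, in_J c d x -> 0 < Derive h x) ->
  forall x y, in_J c d x -> in_J c d y -> x < y -> dinv h x < dinv h y.
Proof.
intros Hcd Hp x y Hx Hy Hxy; apply Rnot_le_lt; intros Hle.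
assert (h (dinv h y) <= h (dinv h x)).
{ destruct Hle as [Hlt | ->]; [|lra].
  left; apply (diffeo_increasing c d h Hp); [| |easy]; now apply dinv_maps_J. }
rewrite !(dinvK c d h) in H by now apply in_J_in_I.
lra.
Qed.

Lemma oriented_le_iter c d (F : R -> R) n x y :
  (forall y, in_J c d y -> in_J c d (F y)) ->
  (forall x y, in_J c d x -> in_J c d y -> x < y -> F x < F y) ->
  in_J c d x -> in_J c d y -> 0 <= (d - c) * (y - x) ->
  0 <= (d - c) * (Nat.iter n F y - Nat.iter n F x).
Proof.
intros HF Hi Hx Hy H.
destruct (Rtotal_order x y) as [L | [-> | L]]; [| nra |].
- pose proof (iter_increasing c d F n x y HF Hi Hx Hy (Rlt_le _ _ L)); nra.
- pose proof (iter_increasing c d F n y x HF Hi Hy Hx (Rlt_le _ _ L)); nra.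
Qed.

(** As [f] is increasing, one step away from [d] would be followed only by
    such steps, and the orbit could not tend to [d]. *)
Lemma S_minus_advances c d (f : diffeo c d) :
  c <> d -> fixed_point_free f -> S_minus f ->
  forall x, in_J c d x -> 0 < (d - c) * (f x - x).
Proof.
intros Hcd Hf HS x Hx; apply Rnot_le_lt; intros Hle.
assert (HJ := fun y => diffeo_maps_J c d f y Hcd).
assert (Hinc := diffeo_increasing c d f
  (fixed_point_free_increasing c d f Hcd Hf)).
assert (Hstep : forall n, (d - c) * Nat.iter n f x <= (d - c) * x).
{ induction n as [|n IH]; [now apply Rle_refl|].
  assert (H := oriented_le_iter c d f n (f x) x HJ Hinc (HJ x Hx) Hx).
  rewrite Nat.iter_succ_r; nra. }
assert (H := is_lim_seq_le _ _ _ _ Hstep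
  (is_lim_seq_scal_l _ (d - c) d (HS x Hx)) (is_lim_seq_const _)).
cbn in H; apply in_J_oriented in Hx; nra.
Qed.

Lemma dinv_recedes c d (f : diffeo c d) :
  c <> d -> (forall x, in_J c d x -> 0 < (d - c) * (f x - x)) ->
  forall x, in_J c d x -> 0 < (c - d) * (dinv f x - x).
Proof.
intros Hcd Ha x Hx; specialize (Ha _ (dinv_maps_J c d f x Hcd Hx)).
rewrite (dinvK c d f) in Ha by now apply in_J_in_I.
lra.
Qed.

Lemma is_lim_seq_inj (u : nat -> R) (l1 l2 : R) :
  is_lim_seq u l1 -> is_lim_seq u l2 -> l1 = l2.
Proof.
intros H1 H2; apply is_lim_seq_unique in H1, H2.
assert (E : Finite l1 = Finite l2) by congruence.
now injection E.
Qed.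

(** Backward orbits are monotone; their limit is a fixed point other than
    [d]. *)
Lemma S_minus_backward c d (f : diffeo c d) :
  c <> d -> fixed_point_free f -> S_minus f ->
  forall x, in_J c d x -> is_lim_seq (fun n => Nat.iter n (dinv f) x) c.
Proof.
intros Hcd Hf HS x Hx.
assert (Hr := dinv_recedes c d f Hcd (S_minus_advances c d f Hcd Hf HS)).
assert (HJ : forall n, in_J c d (Nat.iter n (dinv f) x)).
{ intros n; apply iter_in_J; [|easy]; intros y; now apply dinv_maps_J. }
set (v n := (c - d) * Nat.iter n (dinv f) x).
assert (Hv : ex_finite_lim_seq v).
{ apply ex_finite_lim_seq_incr with ((c - d) * c); intros n; unfold v.
  - specialize (Hr _ (HJ n)); rewrite Nat.iter_succ; lra.
  - specialize (HJ n); apply in_J_oriented in HJ; nra. }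
destruct Hv as [l Hl].
set (m := l / (c - d)).
assert (Hm : is_lim_seq (fun n => Nat.iter n (dinv f) x) m).
{ apply is_lim_seq_ext with (fun n => / (c - d) * v n).
  - intros n; unfold v; field; lra.
  - unfold m, Rdiv; rewrite Rmult_comm; now apply (is_lim_seq_scal_l v _ l). }
assert (HmI : in_I c d m).
{ split.
  - apply (is_lim_seq_le (fun _ => Rmin c d) _ (Rmin c d) m) in Hm; auto.
    + intros n; apply Rlt_le, HJ.
    + apply is_lim_seq_const.
  - apply (is_lim_seq_le _ (fun _ => Rmax c d) m (Rmax c d)) in Hm; auto.
    + intros n; apply Rlt_le, HJ.
    + apply is_lim_seq_const. }
assert (Hfix : f m = m).
{ destruct (dfun_smooth c d f) as [D HD].
  assert (H1 := continuous_on_I_lim c d f _ m (smooth_continuous c d f D HD)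
    (fun n => in_J_in_I c d _ (HJ (S n))) HmI
    (proj1 (is_lim_seq_incr_1 _ _) Hm)).
  apply is_lim_seq_ext with (v := fun n => Nat.iter n (dinv f) x) in H1.
  - exact (is_lim_seq_inj _ _ _ H1 Hm).
  - intros n; apply (dinvK c d f), in_J_in_I, HJ. }
destruct (in_I_cases c d m HmI) as [E | [E | H]]; [now rewrite E in Hm| |].
- assert (Hle : v O <= l).
  { apply is_lim_seq_incr_compare; [easy|]; intros n; unfold v.
    specialize (Hr _ (HJ n)); rewrite Nat.iter_succ; lra. }
  replace l with ((c - d) * m) in Hle by (unfold m; field; lra).
  unfold v in Hle; cbn in Hle; rewrite E in Hle.
  apply in_J_oriented in Hx; nra.
- now destruct (Hf m H).
Qed.

(** This holds of [f], and of its inverse with [c] and [d] exchanged: one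
    estimate then serves both one-sided products. *)
Definition sweeps (c d : R) (F : R -> R) : Prop :=
  (forall x, in_J c d x -> in_J c d (F x)) /\
  (forall x y, in_J c d x -> in_J c d y -> x < y -> F x < F y) /\
  (forall x, in_J c d x -> is_lim_seq (fun n => Nat.iter n F x) d).

Lemma S_minus_sweeps c d (f : diffeo c d) :
  c <> d -> fixed_point_free f -> S_minus f -> sweeps c d f.
Proof.
intros Hcd Hf HS; split; [|split]; [| |easy].
- intros x; now apply diffeo_maps_J.
- apply diffeo_increasing; now apply fixed_point_free_increasing.
Qed.

Lemma S_minus_dinv_sweeps c d (f : diffeo c d) :
  c <> d -> fixed_point_free f -> S_minus f -> sweeps d c (dinv f).
Proof.
intros Hcd Hf HS; split; [|split].
- intros x Hx; apply in_J_sym, dinv_maps_J; [easy|]; now apply in_J_sym.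
- intros x y Hx Hy; apply (dinv_increasing c d f); auto using in_J_sym.
  now apply fixed_point_free_increasing.
- intros x Hx; apply (S_minus_backward c d f); auto using in_J_sym.
Qed.

(** * Bounded distortion *)

Lemma ex_series_increments (a : nat -> R) (l : R) k :
  is_lim_seq a l -> ex_series (fun n => a (k + n)%nat - a n).
Proof.
intros Ha; induction k as [|k IH].
- apply ex_series_ext with (fun _ => 0).
  + intros n; cbn; ring.
  + exists 0; apply filterlim_ext with (fun _ : nat => 0).
    * intros n; rewrite sum_n_const; cbn; now rewrite Rmult_0_r.
    * apply filterlim_const.
- assert (H1 : ex_series (fun n => a (S n) - a n)).
  { exists (l - a O).
    apply filterlim_ext with (fun n => a (S n) - a O).
    - induction x as [|n IHn]; [now rewrite sum_O|].
      rewrite sum_Sn, <- IHn; unfold plus; cbn; ring.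
    - apply is_lim_seq_minus'; [|apply is_lim_seq_const].
      now apply is_lim_seq_incr_1 in Ha. }
  apply (ex_series_incr_n _ k) in H1.
  apply ex_series_ext with
    (fun n => plus (a (S (k + n)) - a (k + n)%nat) (a (k + n)%nat - a n)).
  + intros n; unfold plus; cbn; ring.
  + exact (ex_series_plus _ _ H1 IH).
Qed.

(** If [y] lies between [x] and [F^k x], the distance between the two orbits
    at time [n] is at most the increment from [F^n x] to [F^(n+k) x], and
    these increments telescope. *)
Lemma sweeps_summable c d F x y :
  c <> d -> sweeps c d F -> in_J c d x -> in_J c d y ->
  ex_series (fun n => Rabs (Nat.iter n F x - Nat.iter n F y)).
Proof.
intros Hcd (HJ & Hi & Hl).
assert (Hw : forall x y, in_J c d x -> in_J c d y -> 0 <= (d - c) * (y - x) ->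
  ex_series (fun n => Rabs (Nat.iter n F x - Nat.iter n F y))).
{ clear x y; intros x y Hx Hy Hxy.
  assert (Hk : exists k, 0 <= (d - c) * (Nat.iter k F x - y)).
  { assert (Hly : is_lim_seq (fun n => (d - c) * (Nat.iter n F x - y))
      ((d - c) * (d - y))).
    { apply (is_lim_seq_scal_l _ (d - c) (d - y)).
      apply is_lim_seq_minus'; [now apply Hl | apply is_lim_seq_const]. }
    apply in_J_oriented in Hy; destruct Hy as [_ Hy].
    apply is_lim_seq_spec in Hly.
    destruct (Hly (mkposreal _ Hy)) as [k Hk]; exists k.
    specialize (Hk k (le_n k)); cbn in Hk; apply Rabs_def2 in Hk; lra. }
  destruct Hk as [k Hk].
  apply (ex_series_le (V := R_CompleteNormedModule) _ (fun n => / Rabs (d - c) *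
    ((d - c) * (Nat.iter (k + n) F x - Nat.iter n F x)))).
  - intros n; change (norm ?z) with (Rabs z); rewrite Rabs_Rabsolu.
    assert (Hp : 0 < Rabs (d - c)) by (apply Rabs_pos_lt; lra).
    apply Rmult_le_reg_l with (Rabs (d - c)); [easy|].
    rewrite <- Rmult_assoc, Rinv_r, Rmult_1_l by lra.
    assert (H1 := oriented_le_iter c d F n x y HJ Hi Hx Hy Hxy).
    assert (H2 := oriented_le_iter c d F n y (Nat.iter k F x) HJ Hi Hy
      (iter_in_J c d F k x HJ Hx) Hk).
    rewrite <- Nat.iter_add, Nat.add_comm in H2.
    rewrite <- Rabs_mult, Rabs_left1; lra.
  - apply (ex_series_scal_l (V := R_NormedModule) (/ Rabs (d - c))).
    apply (ex_series_scal_l (V := R_NormedModule) (d - c)).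
    apply (ex_series_increments (fun n => Nat.iter n F x) d), Hl, Hx. }
intros Hx Hy; destruct (Rle_lt_dec 0 ((d - c) * (y - x))) as [H|H].
- now apply Hw.
- apply ex_series_ext with (fun n => Rabs (Nat.iter n F y - Nat.iter n F x)).
  + intros n; apply Rabs_minus_sym.
  + apply Hw; try easy; lra.
Qed.

Lemma ln_Derive_series c d (f : diffeo c d) (u v : nat -> R) :
  c <> d -> fixed_point_free f ->
  (forall n, in_J c d (u n)) -> (forall n, in_J c d (v n)) ->
  ex_series (fun n => Rabs (u n - v n)) ->
  ex_series (fun n => ln (Derive f (u n)) - ln (Derive f (v n))).
Proof.
intros Hcd Hf Hu Hv Hs.
destruct (ln_Derive_Lipschitz c d f Hcd (fixed_point_free_increasing c d f Hcd Hf))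
  as (K & HK & HL).
apply (ex_series_le (V := R_CompleteNormedModule) _
  (fun n => K * Rabs (u n - v n))).
- intros n; now apply HL.
- now apply (ex_series_scal_l (V := R_NormedModule) K).
Qed.

(** * Convergence of the products *)

Lemma prod_exp_sum (u : nat -> R) N :
  (forall n, 0 < u n) -> prod_f_R0 u N = exp (sum_n (fun n => ln (u n)) N).
Proof.
intros Hu; induction N as [|N IH].
- now rewrite sum_O, exp_ln.
- change (prod_f_R0 u (S N)) with (prod_f_R0 u N * u (S N)).
  rewrite sum_Sn, IH; change (plus ?s ?t) with (s + t).
  now rewrite exp_plus, exp_ln.
Qed.

Lemma prod_converges_ln (u : nat -> R) :
  (forall n, 0 < u n) ->
  prod_converges u <-> ex_series (fun n => ln (u n)).
Proof.
intros Hu; split.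
- intros (l & Hl & H); exists (ln l).
  assert (Hp : 0 < l).
  { assert (0 <= l); [|lra].
    apply (is_lim_seq_le (fun _ => 0) (prod_f_R0 u) 0 l); [|apply is_lim_seq_const|easy].
    intros n; rewrite prod_exp_sum by easy; apply Rlt_le, exp_pos. }
  apply filterlim_ext with (fun N => ln (prod_f_R0 u N)).
  + intros N; rewrite prod_exp_sum by easy; apply ln_exp.
  + apply (is_lim_seq_continuous ln); [|easy].
    apply derivable_continuous_pt; exists (/ l); now apply derivable_pt_lim_ln.
- intros [s Hs]; exists (exp s); split; [apply Rgt_not_eq, exp_pos|].
  apply is_lim_seq_ext with (fun N => exp (sum_n (fun n => ln (u n)) N)).
  + intros N; now rewrite prod_exp_sum.
  + apply (is_lim_seq_continuous exp); [|exact Hs].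
    apply derivable_continuous_pt, derivable_pt_exp.
Qed.

Lemma inf_prod_ln (u : nat -> R) :
  (forall n, 0 < u n) -> ex_series (fun n => ln (u n)) ->
  inf_prod u = exp (Series (fun n => ln (u n))).
Proof.
intros Hu Hs; unfold inf_prod.
rewrite (is_lim_seq_unique _ (exp (Series (fun n => ln (u n))))); [easy|].
apply is_lim_seq_ext with (fun N => exp (sum_n (fun n => ln (u n)) N)).
- intros N; now rewrite prod_exp_sum.
- apply (is_lim_seq_continuous exp); [|exact (Series_correct _ Hs)].
  apply derivable_continuous_pt, derivable_pt_exp.
Qed.

Lemma sweeps_iter_in_J c d F n x :
  sweeps c d F -> in_J c d x -> in_J c d (Nat.iter n F x).
Proof. intros [H _]; now apply iter_in_J. Qed.

Lemma dinv_iter_in_J c d (f : diffeo c d) n x :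
  c <> d -> in_J c d x -> in_J c d (Nat.iter n (dinv f) x).
Proof. intros Hcd; apply iter_in_J; intros y; now apply dinv_maps_J. Qed.

Lemma H1_factor_ln c d (f g : diffeo c d) x xi n :
  c <> d -> fixed_point_free f -> fixed_point_free g ->
  in_J c d x -> in_J c d xi ->
  0 < H1_factor f g x xi n /\
  ln (H1_factor f g x xi n) =
    ln (Derive f (Nat.iter n f x)) - ln (Derive g (Nat.iter n g xi)).
Proof.
intros Hcd Hf Hg Hx Hxi; unfold H1_factor.
assert (Pf := fixed_point_free_increasing c d f Hcd Hf _
  (iter_in_J c d f n x (fun y => diffeo_maps_J c d f y Hcd) Hx)).
assert (Pg := fixed_point_free_increasing c d g Hcd Hg _
  (iter_in_J c d g n xi (fun y => diffeo_maps_J c d g y Hcd) Hxi)).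
split; [now apply Rdiv_lt_0_compat | now apply ln_div].
Qed.

Lemma H2_factor_ln c d (f g : diffeo c d) x xi n :
  c <> d -> fixed_point_free f -> fixed_point_free g ->
  in_J c d x -> in_J c d xi ->
  0 < H2_factor f g x xi n /\
  ln (H2_factor f g x xi n) =
    ln (Derive g (Nat.iter (S n) (dinv g) xi)) -
    ln (Derive f (Nat.iter (S n) (dinv f) x)).
Proof.
intros Hcd Hf Hg Hx Hxi; unfold H2_factor.
assert (Pf := fixed_point_free_increasing c d f Hcd Hf _
  (dinv_iter_in_J c d f (S n) x Hcd Hx)).
assert (Pg := fixed_point_free_increasing c d g Hcd Hg _
  (dinv_iter_in_J c d g (S n) xi Hcd Hxi)).
split; [now apply Rdiv_lt_0_compat | now apply ln_div].
Qed.

Lemma ex_series_ln_forward c d (f : diffeo c d) x y :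
  c <> d -> fixed_point_free f -> S_minus f -> in_J c d x -> in_J c d y ->
  ex_series (fun n =>
    ln (Derive f (Nat.iter n f x)) - ln (Derive f (Nat.iter n f y))).
Proof.
intros Hcd Hf HS Hx Hy; assert (Hs := S_minus_sweeps c d f Hcd Hf HS).
apply (ln_Derive_series c d f); auto; try (intros n; now apply sweeps_iter_in_J).
now apply sweeps_summable with c d.
Qed.

Lemma ex_series_ln_backward c d (f : diffeo c d) x y :
  c <> d -> fixed_point_free f -> S_minus f -> in_J c d x -> in_J c d y ->
  ex_series (fun n => ln (Derive f (Nat.iter (S n) (dinv f) x)) -
    ln (Derive f (Nat.iter (S n) (dinv f) y))).
Proof.
intros Hcd Hf HS Hx Hy.
apply (ln_Derive_series c d f); auto; try (intros n; now apply dinv_iter_in_J).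
apply (ex_series_incr_1
  (fun n => Rabs (Nat.iter n (dinv f) x - Nat.iter n (dinv f) y))).
apply sweeps_summable with d c; auto using in_J_sym.
now apply S_minus_dinv_sweeps.
Qed.

Lemma H1_converges_everywhere c d (f g : diffeo c d) x0 xi0 x xi :
  c <> d -> fixed_point_free f -> fixed_point_free g -> S_minus f -> S_minus g ->
  in_J c d x0 -> in_J c d xi0 -> in_J c d x -> in_J c d xi ->
  prod_converges (H1_factor f g x0 xi0) -> prod_converges (H1_factor f g x xi).
Proof.
intros Hcd Hf Hg HfS HgS Hx0 Hxi0 Hx Hxi; rewrite !prod_converges_ln;
  try (intros n; now apply H1_factor_ln); intros H.
assert (Hs := ex_series_plus _ _ (ex_series_plus _ _ H
  (ex_series_ln_forward c d f x x0 Hcd Hf HfS Hx Hx0))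
  (ex_series_ln_forward c d g xi0 xi Hcd Hg HgS Hxi0 Hxi)).
refine (ex_series_ext _ _ _ Hs); intros n.
rewrite !(fun x xi Hx Hxi => proj2 (H1_factor_ln c d f g x xi n Hcd Hf Hg Hx Hxi))
  by easy.
unfold plus; cbn; ring.
Qed.

Lemma H2_converges_everywhere c d (f g : diffeo c d) x0 xi0 x xi :
  c <> d -> fixed_point_free f -> fixed_point_free g -> S_minus f -> S_minus g ->
  in_J c d x0 -> in_J c d xi0 -> in_J c d x -> in_J c d xi ->
  prod_converges (H2_factor f g x0 xi0) -> prod_converges (H2_factor f g x xi).
Proof.
intros Hcd Hf Hg HfS HgS Hx0 Hxi0 Hx Hxi; rewrite !prod_converges_ln;
  try (intros n; now apply H2_factor_ln); intros H.
assert (Hs := ex_series_plus _ _ (ex_series_plus _ _ H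
  (ex_series_ln_backward c d f x0 x Hcd Hf HfS Hx0 Hx))
  (ex_series_ln_backward c d g xi xi0 Hcd Hg HgS Hxi Hxi0)).
refine (ex_series_ext _ _ _ Hs); intros n.
rewrite !(fun x xi Hx Hxi => proj2 (H2_factor_ln c d f g x xi n Hcd Hf Hg Hx Hxi))
  by easy.
unfold plus; cbn; ring.
Qed.

(** * The product [H1] as the right-hand side of a differential equation *)

Lemma H1_exp_Series c d (f g : diffeo c d) x xi :
  c <> d -> fixed_point_free f -> fixed_point_free g ->
  in_J c d x -> in_J c d xi -> prod_converges (H1_factor f g x xi) ->
  ex_series (fun n =>
    ln (Derive f (Nat.iter n f x)) - ln (Derive g (Nat.iter n g xi))) /\
  H1 f g x xi = exp (Series (fun n =>
    ln (Derive f (Nat.iter n f x)) - ln (Derive g (Nat.iter n g xi)))).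
Proof.
intros Hcd Hf Hg Hx Hxi H.
assert (E := fun n => H1_factor_ln c d f g x xi n Hcd Hf Hg Hx Hxi).
rewrite prod_converges_ln in H by (intros n; apply E).
split; [refine (ex_series_ext _ _ _ H); intros n; apply E|].
unfold H1; rewrite inf_prod_ln; [|intros n; apply E | easy].
f_equal; apply Series_ext; intros n; apply E.
Qed.

Lemma H1_shift c d (f g : diffeo c d) x xi :
  c <> d -> fixed_point_free f -> fixed_point_free g ->
  in_J c d x -> in_J c d xi ->
  prod_converges (H1_factor f g x xi) ->
  prod_converges (H1_factor f g (f x) (g xi)) ->
  Derive g xi * H1 f g x xi = Derive f x * H1 f g (f x) (g xi).
Proof.
intros Hcd Hf Hg Hx Hxi H H'.
assert (Hfx := diffeo_maps_J c d f x Hcd Hx).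
assert (Hgxi := diffeo_maps_J c d g xi Hcd Hxi).
destruct (H1_exp_Series c d f g x xi) as [Hs ->]; auto.
destruct (H1_exp_Series c d f g (f x) (g xi)) as [Hs' ->]; auto.
rewrite Series_incr_1 by easy; cbn [Nat.iter nat_rect].
assert (Pf := fixed_point_free_increasing c d f Hcd Hf x Hx).
assert (Pg := fixed_point_free_increasing c d g Hcd Hg xi Hxi).
rewrite exp_plus; unfold Rminus at 1; rewrite exp_plus, exp_Ropp, !exp_ln by easy.
rewrite (Series_ext _ (fun n => ln (Derive f (Nat.iter n f (f x))) -
  ln (Derive g (Nat.iter n g (g xi))))).
- field; lra.
- intros n; now rewrite <- !Nat.iter_succ_r.
Qed.

Lemma continuity_pt_iter_diffeo c d (g : diffeo c d) n x :
  c <> d -> in_J c d x -> continuity_pt (fun y => Nat.iter n g y) x.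
Proof.
intros Hcd Hx; induction n as [|n IH].
- apply (derivable_continuous_pt id), derivable_pt_id.
- apply (continuity_pt_comp (fun y => Nat.iter n g y) g); [easy|].
  apply derivable_continuous_pt, ex_derive_Reals_0; eexists.
  apply diffeo_is_derive, iter_in_J; [|easy].
  intros y; now apply diffeo_maps_J.
Qed.

Lemma continuity_pt_ln_Derive c d (g : diffeo c d) x :
  c <> d -> fixed_point_free g -> in_J c d x ->
  continuity_pt (fun y => ln (Derive g y)) x.
Proof.
intros Hcd Hg Hx.
destruct (ln_Derive_Lipschitz c d g Hcd
  (fixed_point_free_increasing c d g Hcd Hg)) as (K & HK & HL).
destruct (locally_in_J c d x Hx) as [del Hdel].
intros eps Heps; exists (Rmin del (eps / K)).
assert (He : 0 < eps / K) by now apply Rdiv_lt_0_compat.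
split; [now apply Rmin_pos; [apply cond_pos|]|].
intros y [_ Hy]; cbn in *; unfold Rdist in *.
assert (L1 := Rmin_l del (eps / K)); assert (L2 := Rmin_r del (eps / K)).
eapply Rle_lt_trans; [apply HL; [|easy]|].
- apply Hdel; change (Rabs (y - x) < del); lra.
- replace eps with (K * (eps / K)) by (field; lra).
  apply Rmult_lt_compat_l; lra.
Qed.

Lemma CVU_dom_M_test (u : nat -> R -> R) (b : nat -> R) (D : R -> Prop) :
  (forall n x, D x -> Rabs (u n x) <= b n) -> ex_series b ->
  CVU_dom (fun N x => sum_n (fun n => u n x) N) D.
Proof.
intros Hb Hs; apply CVU_dom_cauchy; intros eps.
destruct (Cauchy_ex_series (V := R_CompleteNormedModule) b Hs eps) as [N HN].
assert (H : forall n m x, D x -> (N <= n)%nat -> (n <= m)%nat ->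
  Rabs (sum_n (fun n => u n x) n - sum_n (fun n => u n x) m) < eps).
{ intros n m x Dx Hn Hm; rewrite Rabs_minus_sym.
  replace (sum_n (fun n => u n x) m - sum_n (fun n => u n x) n)
    with (sum_n_m (fun n => u n x) (S n) m)
    by exact (sum_n_m_sum_n (G := R_AbelianGroup) (fun n => u n x) n m Hm).
  eapply Rle_lt_trans; [|exact (HN (S n) m ltac:(lia) ltac:(lia))].
  eapply Rle_trans; [exact (norm_sum_n_m (fun n => u n x) (S n) m)|].
  eapply Rle_trans; [|apply Rle_abs].
  apply sum_n_m_le; intros k; now apply Hb. }
exists N; intros n m x Dx Hn Hm; destruct (Nat.le_ge_cases n m).
- now apply H.
- rewrite Rabs_minus_sym; now apply H.
Qed.

(** The series converges uniformly between any two interior points, by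
    comparison with the distance of their orbits. *)
Lemma continuous_distortion c d (g : diffeo c d) y0 y :
  c <> d -> fixed_point_free g -> S_minus g -> in_J c d y0 -> in_J c d y ->
  continuous (fun z => Series (fun n =>
    ln (Derive g (Nat.iter n g z)) - ln (Derive g (Nat.iter n g y0)))) y.
Proof.
intros Hcd Hg HS Hy0 Hy; apply continuity_pt_filterlim.
assert (Hp := fixed_point_free_increasing c d g Hcd Hg).
destruct (ln_Derive_Lipschitz c d g Hcd Hp) as (K & HK & HL).
assert (Hs := S_minus_sweeps c d g Hcd Hg HS).
destruct Hs as (HJ & Hi & Hl).
assert (HIt := fun n x => iter_in_J c d g n x HJ).
assert (Hab : exists a b, in_J c d a /\ in_J c d b /\ a < y < b).
{ exists ((Rmin c d + y) / 2), ((y + Rmax c d) / 2); unfold in_J in *; lra. }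
destruct Hab as (a & b & Ha & Hb & Hab).
set (ell z := ln (Derive g z)); fold (ell y0).
assert (Hsum : ex_series (fun n => K *
  (Rabs (Nat.iter n g a - Nat.iter n g b) +
   Rabs (Nat.iter n g a - Nat.iter n g y0)))).
{ apply (ex_series_scal_l (V := R_NormedModule) K).
  now apply (ex_series_plus (V := R_NormedModule));
    apply sweeps_summable with c d. }
apply (CVU_cont_open (fun N z => sum_n (fun n =>
  ell (Nat.iter n g z) - ell (Nat.iter n g y0)) N) (fun z => a < z < b)); [| | |easy].
- apply (open_and (fun z => a < z) (fun z => z < b));
    [apply open_gt | apply open_lt].
- refine (CVU_dom_M_test _ _ _ _ Hsum); intros n z Hz.
  assert (HzJ : in_J c d z) by (apply in_J_between with a b; auto; lra).
  eapply Rle_trans; [apply HL; auto|].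
  apply Rmult_le_compat_l; [lra|].
  assert (L1 := iter_increasing c d g n a z HJ Hi Ha HzJ ltac:(lra)).
  assert (L2 := iter_increasing c d g n z b HJ Hi HzJ Hb ltac:(lra)).
  unfold Rabs; repeat destruct Rcase_abs; lra.
- intros N z Hz; assert (HzJ : in_J c d z).
  { apply in_J_between with a b; auto; lra. }
  induction N as [|N IH].
  + apply continuity_pt_ext with (fun z => ell z - ell y0).
    * intros t; now rewrite sum_O.
    * apply continuity_pt_minus; [now apply continuity_pt_ln_Derive|].
      now apply continuity_pt_const.
  + apply continuity_pt_ext with (fun z =>
      sum_n (fun n => ell (Nat.iter n g z) - ell (Nat.iter n g y0)) N +
      (ell (Nat.iter (S N) g z) - ell (Nat.iter (S N) g y0))).
    * intros t; now rewrite sum_Sn.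
    * apply continuity_pt_plus; [easy|].
      apply continuity_pt_minus; [|now apply continuity_pt_const].
      apply (continuity_pt_comp (fun y => Nat.iter (S N) g y) ell).
      -- now apply continuity_pt_iter_diffeo.
      -- apply continuity_pt_ln_Derive; auto.
Qed.

(** Separation of variables: a primitive of [q] composed with either solution
    has derivative [P], and this primitive is injective. *)
Lemma separable_unique c d (P q y1 y2 : R -> R) a :
  (forall x, in_J c d x -> continuous q x) ->
  (forall x, in_J c d x -> 0 < q x) ->
  (forall x, in_J c d x -> in_J c d (y1 x) /\ in_J c d (y2 x)) ->
  (forall x, in_J c d x -> is_derive y1 x (P x / q (y1 x))) ->
  (forall x, in_J c d x -> is_derive y2 x (P x / q (y2 x))) ->
  in_J c d a -> y1 a = y2 a -> forall x, in_J c d x -> y1 x = y2 x.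
Proof.
intros Cq Hq HJ D1 D2 Ha Ea.
set (A := RInt q a : R -> R).
assert (HA : forall y, in_J c d y -> is_derive A y (q y)).
{ intros y Hy; apply is_derive_RInt with a; [|now apply Cq].
  apply filter_imp with (2 := locally_in_J c d y Hy); intros z Hz.
  apply (RInt_correct q), (ex_RInt_continuous q); intros t Ht; apply Cq.
  unfold in_J in *; unfold Rmin at 1, Rmax at 1 in Ht; destruct Rle_dec; lra. }
assert (HAy : forall y x, in_J c d x -> in_J c d (y x) ->
  is_derive y x (P x / q (y x)) -> is_derive (fun t => A (y t)) x (P x)).
{ intros y x Hx Hy Hd.
  replace (P x) with (P x / q (y x) * q (y x)).
  2:{ specialize (Hq _ Hy); field; lra. }
  apply (is_derive_comp A y); auto. }
assert (Hdiff : forall x, in_J c d x ->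
  is_derive (fun t => A (y1 t) - A (y2 t)) x zero).
{ intros x Hx; destruct (HJ x Hx) as [J1 J2].
  assert (H := is_derive_minus _ _ x _ _
    (HAy y1 x Hx J1 (D1 x Hx)) (HAy y2 x Hx J2 (D2 x Hx))).
  rewrite minus_eq_zero in H; exact H. }
assert (HE : forall x, in_J c d x -> A (y1 x) - A (y2 x) = 0).
{ intros x Hx; transitivity (A (y1 a) - A (y2 a)); [|rewrite Ea; ring].
  destruct (Rtotal_order x a) as [L | [-> | L]]; [| easy | symmetry];
    apply (eq_is_derive (fun t => A (y1 t) - A (y2 t))); auto;
    intros t Ht; apply Hdiff.
  - now apply in_J_between with x a.
  - now apply in_J_between with a x. }
intros x Hx; destruct (HJ x Hx) as [J1 J2]; specialize (HE x Hx).
destruct (Rtotal_order (y1 x) (y2 x)) as [L | [E | L]]; [| easy |].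
- apply (increasing_on_J c d A q) in L; auto; lra.
- apply (increasing_on_J c d A q) in L; auto; lra.
Qed.

Lemma H1_pos c d (f g : diffeo c d) x xi :
  c <> d -> fixed_point_free f -> fixed_point_free g ->
  in_J c d x -> in_J c d xi -> prod_converges (H1_factor f g x xi) ->
  0 < H1 f g x xi.
Proof.
intros Hcd Hf Hg Hx Hxi H.
destruct (H1_exp_Series c d f g x xi) as [_ ->]; auto; apply exp_pos.
Qed.

(** Since [H1 x xi] factors as a function of [x] times a function of [xi] and
    [g'(xi) H1 x xi = f'(x) H1 (f x) (g xi)], the functions [phi o f] and
    [g o phi] solve the same separable equation. *)
Lemma Phi_plus_intertwines c d (f g : diffeo c d) a alpha phi :
  c <> d -> fixed_point_free f -> fixed_point_free g -> S_minus f -> S_minus g ->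
  (forall x xi, in_J c d x -> in_J c d xi ->
    prod_converges (H1_factor f g x xi)) ->
  in_J c d a -> is_Phi_plus f g a alpha phi ->
  forall x, in_J c d x -> phi (f x) = g (phi x).
Proof.
intros Hcd Hf Hg HfS HgS HC Ha (lambda & Hl & (HJ & Hd & Hphia) & Hfa).
assert (HfJ := fun x => diffeo_maps_J c d f x Hcd).
assert (HgJ := fun x => diffeo_maps_J c d g x Hcd).
(* [H1 x xi = exp (S x) / exp (L xi)], the orbit of [a] under [g] serving as
   reference. *)
set (S x := Series (fun n =>
  ln (Derive f (Nat.iter n f x)) - ln (Derive g (Nat.iter n g a)))).
set (L y := Series (fun n =>
  ln (Derive g (Nat.iter n g y)) - ln (Derive g (Nat.iter n g a)))).
assert (Hsep : forall x xi, in_J c d x -> in_J c d xi ->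
  H1 f g x xi = exp (S x) / exp (L xi)).
{ intros x xi Hx Hxi.
  destruct (H1_exp_Series c d f g x xi) as [_ ->]; auto.
  unfold Rdiv; rewrite <- exp_Ropp, <- exp_plus; f_equal.
  unfold S, L; change (?s + - ?t) with (s - t).
  rewrite <- Series_minus.
  - apply Series_ext; intros n; ring.
  - now apply (H1_exp_Series c d f g x a); auto.
  - now apply ex_series_ln_forward. }
apply (separable_unique c d (fun x => lambda * Derive f x * exp (S (f x)))
  (fun y => exp (L y)) (fun x => phi (f x)) (fun x => g (phi x)) a).
- intros y Hy; apply (continuous_comp L exp).
  + now apply continuous_distortion.
  + apply continuity_pt_filterlim, derivable_continuous_pt, derivable_pt_exp.
- intros; apply exp_pos.
- auto.
- intros x Hx.
  replace (_ / _) with (Derive f x * (lambda * H1 f g (f x) (phi (f x)))).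
  + apply (is_derive_comp phi f); [now apply Hd, HfJ|].
    now apply diffeo_is_derive.
  + rewrite Hsep by auto; unfold Rdiv; ring.
- intros x Hx.
  replace (_ / _) with (lambda * H1 f g x (phi x) * Derive g (phi x)).
  + apply (is_derive_comp g phi); [|now apply Hd].
    now apply diffeo_is_derive, HJ.
  + rewrite Rmult_assoc, (Rmult_comm (H1 _ _ _ _)), H1_shift by auto.
    rewrite Hsep by auto; unfold Rdiv; ring.
- easy.
- now rewrite Hfa, Hphia.
Qed.

(** * Products along an intertwining map *)

(** Differentiating [h o f = g o h] gives [f'(x) / g'(h x) = h'(x) / h'(f x)],
    so that the product along a forward orbit telescopes. *)
Lemma H1_telescopes c d (f g : diffeo c d) (h dh : R -> R) x N :
  c <> d -> (forall x, in_J c d x -> in_J c d (h x)) ->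
  (forall x, in_J c d x -> is_derive h x (dh x)) ->
  (forall x, in_J c d x -> dh x <> 0) ->
  (forall x, in_J c d x -> h (f x) = g (h x)) -> in_J c d x ->
  prod_f_R0 (H1_factor f g x (h x)) N = dh x / dh (Nat.iter (S N) f x) /\
  prod_f_R0 (H2_factor f g x (h x)) N = dh x / dh (Nat.iter (S N) (dinv f) x).
Proof.
intros Hcd HJ Hd Hne Hc Hx.
assert (HfJ := fun x => diffeo_maps_J c d f x Hcd).
assert (HgJ := fun x => diffeo_maps_J c d g x Hcd).
assert (Hinv : forall x, in_J c d x -> h (dinv f x) = dinv g (h x)).
{ clear x Hx; intros x Hx; assert (Hfx := dinv_maps_J c d f x Hcd Hx).
  rewrite <- (dinvK c d f x) at 2 by now apply in_J_in_I.
  rewrite Hc by easy; symmetry; apply (dfunK c d g), in_J_in_I; auto. }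
assert (Hchain : forall x, in_J c d x ->
  dh (f x) * Derive f x = Derive g (h x) * dh x).
{ clear x Hx; intros x Hx.
  transitivity (Derive (fun t => h (f t)) x); [symmetry|].
  - apply is_derive_unique; rewrite Rmult_comm.
    apply (is_derive_comp h f); [now apply Hd, HfJ | now apply diffeo_is_derive].
  - apply is_derive_unique; rewrite Rmult_comm.
    apply is_derive_ext_loc with (fun t => g (h t)).
    + apply filter_imp with (2 := locally_in_J c d x Hx).
      intros t Ht; now rewrite Hc.
    + apply (is_derive_comp g h); [|now apply Hd].
      now apply diffeo_is_derive, HJ. }
assert (Hgne := fun y => diffeo_Derive_neq0 c d g y Hcd).
assert (Hfne := fun y => diffeo_Derive_neq0 c d f y Hcd).
assert (Hfac : forall y, in_J c d y ->
  Derive f y / Derive g (h y) = dh y / dh (f y)).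
{ intros y Hy; specialize (Hchain y Hy).
  assert (N1 := Hgne _ (HJ y Hy)); assert (N2 := Hne _ (HfJ y Hy)).
  apply Rmult_eq_reg_r with (Derive g (h y) * dh (f y)); [|now apply Rmult_integral_contrapositive].
  field_simplify; [|easy..]; lra. }
assert (Hit1 : forall n, Nat.iter n g (h x) = h (Nat.iter n f x)).
{ induction n as [|n IH]; [easy|]; rewrite !Nat.iter_succ, IH, Hc; [easy|].
  now apply iter_in_J. }
assert (Hit2 : forall n, Nat.iter n (dinv g) (h x) = h (Nat.iter n (dinv f) x)).
{ induction n as [|n IH]; [easy|]; rewrite !Nat.iter_succ, IH, Hinv; [easy|].
  now apply dinv_iter_in_J. }
split.
- assert (HI := fun n => iter_in_J c d f n x HfJ Hx).
  assert (HF : forall n, H1_factor f g x (h x) n =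
    dh (Nat.iter n f x) / dh (Nat.iter (S n) f x)).
  { intros n; unfold H1_factor; rewrite Hit1; now apply Hfac. }
  induction N as [|N IH]; [exact (HF O)|].
  change (prod_f_R0 ?u (S ?n)) with (prod_f_R0 u n * u (S n)).
  rewrite IH, HF; field; split; apply Hne, HI.
- assert (HI := fun n => dinv_iter_in_J c d f n x Hcd Hx).
  assert (HF : forall n, H2_factor f g x (h x) n =
    dh (Nat.iter n (dinv f) x) / dh (Nat.iter (S n) (dinv f) x)).
  { intros n; unfold H2_factor; rewrite Hit2.
    specialize (Hfac _ (HI (S n))); specialize (HI (S n)) as HI'.
    rewrite Nat.iter_succ, (dinvK c d f), <- Nat.iter_succ in Hfac
      by (apply in_J_in_I, HI).
    rewrite <- Rinv_div, Hfac, Rinv_div; reflexivity. }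
  induction N as [|N IH]; [exact (HF O)|].
  change (prod_f_R0 ?u (S ?n)) with (prod_f_R0 u n * u (S n)).
  rewrite IH, HF; field; split; apply Hne, HI.
Qed.

Lemma S_minus_fixes_ends c d (f : diffeo c d) :
  c <> d -> fixed_point_free f -> S_minus f -> f c = c /\ f d = d.
Proof.
intros Hcd Hf HS.
set (x := (c + d) / 2); assert (Hx : in_J c d x) by now apply in_J_midpoint.
assert (HfJ := fun x => diffeo_maps_J c d f x Hcd).
destruct (dfun_smooth c d f) as [D HD].
assert (Cf := smooth_continuous c d f D HD).
split.
- assert (H := S_minus_backward c d f Hcd Hf HS x Hx).
  assert (HI := fun n => in_J_in_I c d _ (dinv_iter_in_J c d f n x Hcd Hx)).
  assert (H1 := continuous_on_I_lim c d f _ c Cf (fun n => HI (S n))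
    (in_I_left c d) (proj1 (is_lim_seq_incr_1 _ _) H)).
  apply is_lim_seq_ext with (v := fun n => Nat.iter n (dinv f) x) in H1.
  + exact (is_lim_seq_inj _ _ _ H1 H).
  + intros n; apply (dinvK c d f), HI.
- assert (H := HS x Hx).
  assert (HI := fun n => in_J_in_I c d _ (iter_in_J c d f n x HfJ Hx)).
  assert (H1 := continuous_on_I_lim c d f _ d Cf HI (in_I_right c d) H).
  apply (is_lim_seq_inj _ _ _ H1).
  now apply (is_lim_seq_incr_1 (fun n => Nat.iter n f x)) in H.
Qed.

(** A conjugacy carries forward orbits of [f] to forward orbits of [g], which
    have the same direction; it is therefore increasing. *)
Lemma conjugacy_increasing c d (f g h : diffeo c d) :
  c <> d -> fixed_point_free f -> fixed_point_free g -> S_minus f -> S_minus g ->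
  (forall x, in_J c d x -> h (f x) = g (h x)) ->
  forall x, in_J c d x -> 0 < Derive h x.
Proof.
intros Hcd Hf Hg HfS HgS Hc; destruct (diffeo_monotone c d h Hcd) as [|Hn];
  [easy|exfalso].
set (x := (c + d) / 2); assert (Hx : in_J c d x) by now apply in_J_midpoint.
assert (Hfx := diffeo_maps_J c d f x Hcd Hx).
assert (A1 := S_minus_advances c d f Hcd Hf HfS x Hx).
assert (A2 := S_minus_advances c d g Hcd Hg HgS _ (diffeo_maps_J c d h x Hcd Hx)).
rewrite <- Hc in A2 by easy.
assert (Hdec : forall y z, in_J c d y -> in_J c d z -> y < z -> h z < h y).
{ intros y z Hy Hz Hyz; apply Ropp_lt_cancel.
  apply (increasing_on_J c d (fun t => - h t) (fun t => - Derive h t)); auto.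
  - intros t Ht; apply (is_derive_opp h); now apply diffeo_is_derive.
  - intros t Ht; specialize (Hn t Ht); lra. }
destruct (Rtotal_order (f x) x) as [L | [E | L]].
- specialize (Hdec _ _ Hfx Hx L); nra.
- rewrite E in A1; lra.
- specialize (Hdec _ _ Hx Hfx L); nra.
Qed.

Lemma is_lim_seq_div_const (a : R) (u : nat -> R) (l : R) :
  is_lim_seq u l -> l <> 0 -> is_lim_seq (fun n => a / u n) (a / l).
Proof.
intros H Hl; apply (is_lim_seq_div' (fun _ => a)); auto.
apply is_lim_seq_const.
Qed.

(** The telescoped products tend to [h'(x) / h'(d)] and [h'(x) / h'(c)]. *)
Lemma conjugacy_is_Phi c d (f g h : diffeo c d) a :
  c <> d -> fixed_point_free f -> fixed_point_free g -> S_minus f -> S_minus g ->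
  (forall x, in_J c d x -> h (f x) = g (h x)) -> in_J c d a ->
  H_converges f g a (h a) /\
  is_Phi_plus f g a (h a) h /\ is_Phi_minus f g a (h a) h.
Proof.
intros Hcd Hf Hg HfS HgS Hc Ha.
assert (Hp := conjugacy_increasing c d f g h Hcd Hf Hg HfS HgS Hc).
assert (HhJ := fun x => diffeo_maps_J c d h x Hcd).
assert (HfJ := fun x => diffeo_maps_J c d f x Hcd).
destruct (diffeo_derivatives c d h Hcd) as (D & E & HD & _ & HDE).
assert (Hne : forall x, in_I c d x -> D 1%nat x <> 0).
{ intros x Hx E0; specialize (HDE x Hx); rewrite E0 in HDE; lra. }
assert (HpD : forall x, in_J c d x -> 0 < D 1%nat x).
{ intros x Hx; specialize (Hp x Hx).
  now rewrite (derivatives_Derive c d h D) in Hp. }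
assert (CD := derivatives_continuous c d h D 1 HD).
assert (Hlim : forall (u : nat -> R) l, in_I c d l -> (forall n, in_J c d (u n)) ->
  is_lim_seq u l -> 0 < D 1%nat l /\
  forall x, is_lim_seq (fun n => D 1%nat x / D 1%nat (u (S n)))
    (D 1%nat x / D 1%nat l)).
{ intros u l Hl Hu H.
  assert (HL := continuous_on_I_lim c d _ u l CD
    (fun n => in_J_in_I c d _ (Hu n)) Hl H).
  split.
  - assert (0 <= D 1%nat l); [|specialize (Hne l Hl); lra].
    apply (is_lim_seq_le (fun _ => 0) (fun n => D 1%nat (u n)) 0 (D 1%nat l)); auto.
    + intros n; apply Rlt_le, HpD, Hu.
    + apply is_lim_seq_const.
  - intros x; apply is_lim_seq_div_const; [|now apply Hne].
    now apply (is_lim_seq_incr_1 (fun n => D 1%nat (u n))). }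
assert (Hd := fun x Hx => Hlim (fun n => Nat.iter n f x) d (in_I_right c d)
  (fun n => iter_in_J c d f n x HfJ Hx) (HfS x Hx)).
assert (Hcc := fun x Hx => Hlim (fun n => Nat.iter n (dinv f) x) c (in_I_left c d)
  (fun n => dinv_iter_in_J c d f n x Hcd Hx)
  (S_minus_backward c d f Hcd Hf HfS x Hx)).
assert (HT := fun x N Hx => H1_telescopes c d f g h (D 1%nat) x N Hcd HhJ
  (fun x => derivatives_is_derive c d h D x HD)
  (fun x Hx => Hne x (in_J_in_I c d x Hx)) Hc Hx).
assert (L1 : forall x, in_J c d x ->
  is_lim_seq (prod_f_R0 (H1_factor f g x (h x))) (D 1%nat x / D 1%nat d)).
{ intros x Hx; apply is_lim_seq_ext with (2 := proj2 (Hd x Hx) x).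
  intros n; symmetry; now apply HT. }
assert (L2 : forall x, in_J c d x ->
  is_lim_seq (prod_f_R0 (H2_factor f g x (h x))) (D 1%nat x / D 1%nat c)).
{ intros x Hx; apply is_lim_seq_ext with (2 := proj2 (Hcc x Hx) x).
  intros n; symmetry; now apply HT. }
assert (Pd := proj1 (Hd a Ha)); assert (Pc := proj1 (Hcc a Ha)).
assert (Hq : forall l, 0 < l -> D 1%nat a / l <> 0).
{ intros l Hl; apply Rgt_not_eq, Rdiv_lt_0_compat; auto. }
split; [|split].
- split; [exists (D 1%nat a / D 1%nat d) | exists (D 1%nat a / D 1%nat c)]; auto.
- exists (D 1%nat d); split; [easy|]; split; [|now apply Hc].
  split; [easy|]; split; [|easy]; intros x Hx.
  replace (_ * _) with (D 1%nat x).
  + now apply derivatives_is_derive with c d.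
  + unfold H1, inf_prod; rewrite (is_lim_seq_unique _ _ (L1 x Hx)).
    cbn; field; lra.
- exists (D 1%nat c); split; [easy|]; split; [|now apply Hc].
  split; [easy|]; split; [|easy]; intros x Hx.
  replace (_ * _) with (D 1%nat x).
  + now apply derivatives_is_derive with c d.
  + unfold H2, inf_prod; rewrite (is_lim_seq_unique _ _ (L2 x Hx)).
    cbn; field; lra.
Qed.

(** Orbits of [f] and [g] tend to the same endpoints, so that the smooth
    extension [u] of an intertwining map fixes these; and [u'] is nonzero
    there since the telescoped products tend to nonzero limits. *)
Lemma intertwining_extends_to_conjugacy c d (f g : diffeo c d)
    (phi dphi : R -> R) a :
  c <> d -> fixed_point_free f -> fixed_point_free g -> S_minus f -> S_minus g ->
  (forall x, in_J c d x -> in_J c d (phi x)) ->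
  (forall x, in_J c d x -> is_derive phi x (dphi x)) ->
  (forall x, in_J c d x -> 0 < dphi x) ->
  (forall x, in_J c d x -> phi (f x) = g (phi x)) ->
  in_J c d a -> H_converges f g a (phi a) ->
  extends_smoothly c d phi -> conjugate f g.
Proof.
intros Hcd Hf Hg HfS HgS HJ Hd Hp Hc Ha [C1 C2] (u & [D HD] & Hu).
assert (HfJ := fun x => diffeo_maps_J c d f x Hcd).
assert (HDphi : forall x, in_J c d x -> D 1%nat x = dphi x).
{ intros x Hx; rewrite <- (derivatives_Derive c d u D) by easy.
  apply is_derive_unique, is_derive_ext_loc with phi; auto.
  apply filter_imp with (2 := locally_in_J c d x Hx).
  intros t Ht; now rewrite Hu. }
assert (Cu := smooth_continuous c d u D HD).
assert (CD := derivatives_continuous c d u D 1 HD).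
assert (HI1 := fun n => iter_in_J c d f n a HfJ Ha).
assert (HI2 := fun n => dinv_iter_in_J c d f n a Hcd Ha).
assert (Hend : forall (x y : nat -> R) l, in_I c d l ->
  (forall n, in_J c d (x n)) -> (forall n, phi (x n) = y n) ->
  is_lim_seq x l -> is_lim_seq y l -> u l = l).
{ intros x y l Hl Hx Hxy Lx Ly.
  assert (H := continuous_on_I_lim c d u x l Cu
    (fun n => in_J_in_I c d _ (Hx n)) Hl Lx).
  apply is_lim_seq_ext with (v := y) in H.
  - exact (is_lim_seq_inj _ _ _ H Ly).
  - intros n; now rewrite Hu. }
assert (Hud : u d = d).
{ apply (Hend (fun n => Nat.iter n f a) (fun n => Nat.iter n g (phi a)));
    auto using in_I_right.
  induction n as [|n IH]; [easy|]; rewrite !Nat.iter_succ, <- IH; auto. }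
assert (Huc : u c = c).
{ apply (Hend (fun n => Nat.iter n (dinv f) a)
    (fun n => Nat.iter n (dinv g) (phi a))); auto using in_I_left.
  - induction n as [|n IH]; [easy|].
    rewrite (Nat.iter_succ _ _ (dinv g)), <- IH.
    rewrite <- (dinvK c d f (Nat.iter n (dinv f) a)) by (apply in_J_in_I, HI2).
    rewrite <- Nat.iter_succ, Hc by auto; symmetry.
    apply (dfunK c d g), in_J_in_I; auto.
  - now apply S_minus_backward.
  - now apply S_minus_backward; auto. }
assert (Hne : forall (x p : nat -> R) l, in_I c d l ->
  (forall n, in_J c d (x n)) -> is_lim_seq x l ->
  (forall n, p n = dphi a / dphi (x (S n))) ->
  (exists L, L <> 0 /\ is_lim_seq p L) -> D 1%nat l <> 0).
{ intros x p l Hl Hx Lx Hxp (L & HL & Lp) E.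
  assert (Pa := Hp a Ha).
  assert (H := continuous_on_I_lim c d _ _ l CD
    (fun n => in_J_in_I c d _ (Hx (S n))) Hl (proj1 (is_lim_seq_incr_1 _ _) Lx)).
  apply is_lim_seq_ext with (v := fun n => dphi a / p n) in H.
  - assert (H' := is_lim_seq_div_const (dphi a) p L Lp HL).
    assert (Q := is_lim_seq_inj _ _ _ H H'); rewrite E in Q.
    symmetry in Q; revert Q; apply Rmult_integral_contrapositive.
    split; [lra|]; now apply Rinv_neq_0_compat.
  - intros n; rewrite Hxp, HDphi by easy.
    specialize (Hp _ (Hx (S n))); field; lra. }
assert (HT := fun N => H1_telescopes c d f g phi dphi a N Hcd HJ Hd
  (fun x Hx => Rgt_not_eq _ _ (Hp x Hx)) Hc Ha).
destruct (diffeo_of_smooth c d u D) as [h Hh]; auto.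
- intros x Hx; destruct (in_I_cases c d x Hx) as [-> | [-> | HxJ]].
  + apply (Hne _ _ c Hx HI2 (S_minus_backward c d f Hcd Hf HfS a Ha)
      (fun n => proj2 (HT n)) C2).
  + apply (Hne _ _ d Hx HI1 (HfS a Ha) (fun n => proj1 (HT n)) C1).
  + rewrite HDphi by easy; now apply Rgt_not_eq, Hp.
- intros x Hx; destruct (in_I_cases c d x Hx) as [-> | [-> | HxJ]].
  + now rewrite Huc.
  + now rewrite Hud.
  + rewrite Hu by easy; now apply in_J_in_I, HJ.
- destruct (S_minus_fixes_ends c d f Hcd Hf HfS) as [fc fd].
  destruct (S_minus_fixes_ends c d g Hcd Hg HgS) as [gc gd].
  exists h; intros x Hx.
  assert (E : h (f x) = g (h x)).
  { rewrite !Hh; destruct (in_I_cases c d x Hx) as [-> | [-> | HxJ]].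
    - now rewrite fc, Huc, gc.
    - now rewrite fd, Hud, gd.
    - rewrite !Hu by auto; auto. }
  rewrite <- E; symmetry; apply (dfunK c d h), (dfun_maps c d f), Hx.
Qed.

Theorem theorem2p8 (c d : R) (hcd : c <> d) (f g : diffeo c d)
    (hf : fixed_point_free f) (hg : fixed_point_free g)
    (hfS : S_minus f) (hgS : S_minus g) :
  let cond1 := conjugate f g in
  let cond2 :=
    (exists x xi : R, in_J c d x /\ in_J c d xi /\ H_converges f g x xi) /\
    (exists a alpha : R, in_J c d a /\ in_J c d alpha /\
       exists phi : R -> R,
         is_Phi_plus f g a alpha phi /\ extends_smoothly c d phi) in
  let cond3 :=
    exists a alpha : R, in_J c d a /\ in_J c d alpha /\
      H_converges f g a alpha /\
      exists phi psi : R -> R,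
        is_Phi_plus f g a alpha phi /\ is_Phi_minus f g a alpha psi /\
        (forall x, in_J c d x -> phi x = psi x) /\
        extends_to_diffeo c d phi in
  (cond1 <-> cond2) /\ (cond2 <-> cond3).
Proof.
intros cond1 cond2 cond3.
assert (H13 : cond1 -> cond3).
{ intros [h Hh]; set (a := (c + d) / 2).
  assert (Ha : in_J c d a) by now apply in_J_midpoint.
  assert (Hc : forall x, in_J c d x -> h (f x) = g (h x)).
  { intros x Hx; rewrite Hh by now apply in_J_in_I.
    now apply (dinvK c d h), (dfun_maps c d g), (dfun_maps c d h), in_J_in_I. }
  destruct (conjugacy_is_Phi c d f g h a) as (HC & Hp & Hm); auto.
  exists a, (h a); split; [easy|]; split; [now apply diffeo_maps_J|].
  split; [easy|]; exists h, h; split; [easy|]; split; [easy|].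
  split; [easy|]; now exists h. }
assert (H32 : cond3 -> cond2).
{ intros (a & alpha & Ha & Hal & HC & phi & psi & Hp & _ & _ & [h Hh]).
  split; [now exists a, alpha|].
  exists a, alpha; split; [easy|]; split; [easy|]; exists phi; split; [easy|].
  exists h; split; [apply dfun_smooth | exact Hh]. }
assert (H21 : cond2 -> cond1).
{ intros [(x0 & xi0 & Hx0 & Hxi0 & [C1 C2]) (a & alpha & Ha & Hal & phi & HP & HE)].
  assert (C1' : forall x xi, in_J c d x -> in_J c d xi ->
    prod_converges (H1_factor f g x xi)).
  { intros x xi Hx Hxi; now apply H1_converges_everywhere with x0 xi0. }
  assert (Hc := Phi_plus_intertwines c d f g a alpha phi hcd hf hg hfS hgS C1'
    Ha HP).
  destruct HP as (lambda & Hl & (HJ & Hd & Hphia) & Hfa).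
  apply intertwining_extends_to_conjugacy with
    phi (fun x => lambda * H1 f g x (phi x)) a; auto.
  - intros x Hx; apply Rmult_lt_0_compat; [easy|]; apply H1_pos; auto.
  - split; [now apply C1', HJ|].
    apply H2_converges_everywhere with x0 xi0; auto. }
tauto.
Qed.
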